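(* Let $d\geq 2$ be an integer and let $m^{(d)}_{k,n}$ ($k\in\mathbb{Z}$, $n\in\mathbb{Z}_{\geq 0}$) be the entries of the Motzkin triangle of order $d$. Then for every $n\geq 0$, $$m_{1,2n}^{(d)}=\sum_{k>0}\bigl(m_{k,n}^{(d)}\bigr)^2 .$$
   Context: For $d\geq 2$, the Motzkin triangle of order $d$ is the family of integers $m^{(d)}_{k,n}$ ($k\in\mathbb{Z}$, $n\in\mathbb{Z}_{\geq0}$) defined by $m^{(d)}_{-1,0}=-1$, $m_{1,0}^{(d)}=1$, $m_{i,0}^{(d)}=0$ for all $i\neq-1,1$, and the recurrence $$m_{k,n+1}^{(d)}=m_{k-(d-1),n}^{(d)}+m_{k-(d-2),n}^{(d)}+\dots+m_{k+d-2,n}^{(d)}+m_{k+d-1,n}^{(d)}$$ (a sum of $2d-1$ terms, with first indices in steps of $1$). For fixed $n$ only finitely many $m^{(d)}_{k,n}$ are non-zero. *)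

(* Defs.v *)
From mathcomp Require Import all_boot all_order all_algebra.
From mathcomp Require Import all_classical.
From mathcomp Require Import zify.

Set Implicit Arguments.
Unset Strict Implicit.
Unset Printing Implicit Defensive.

Import Order.TTheory GRing.Theory Num.Theory.

Local Open Scope classical_set_scope.
Local Open Scope ring_scope.

Fixpoint motzkin (d : nat) (k : int) (n : nat) {struct n} : int :=
  match n with
  | 0%N => if k == 1 then 1 else if k == -1 then -1 else 0
  | n'.+1 => \sum_(i < (2 * d - 1)%N) motzkin d (k - (d%:Z - 1) + i%:Z) n'
  end.

Lemma motzkin_eq0 (d n : nat) (k : int) :
  (n * (d - 1) + 1 < `|k|)%N -> motzkin d k n = 0.
Proof.
elim: n k => [|n IHn] k hk /=.
  by case: eqP => [k1|_]; [lia | case: eqP => [k1|_]; [lia|]].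
rewrite big1 // => i _; apply: IHn.
have hi := ltn_ord i; rewrite mulSn in hk; lia.
Qed.

(* The finitely supported sum [\sum_(k \in A) F k] is 0 by convention when F
   has infinite support on A; this lemma rules that case out for the rows of
   the triangle. *)
Lemma finite_motzkin_support (d n : nat) :
  finite_set [set k : int | motzkin d k n != 0].
Proof.
set N := (n * (d - 1) + 1)%N.
apply: (@sub_finite_set _ _ ((fun i : nat => i%:Z - N%:Z) @` `I_(2 * N).+1)).
  move=> k /= k0; have hk : (`|k| <= N)%N.
    by rewrite leqNgt; apply: contra_neqN k0 => /motzkin_eq0.
  exists (absz (k + N%:Z)); lia.
exact/finite_image/finite_II.
Qed.

(* Main.v *)
Require Import Defs.
From mathcomp Require Import all_boot all_order all_algebra.
From mathcomp Require Import all_classical.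
From mathcomp Require Import finmap zify.

Import Order.TTheory GRing.Theory Num.Theory.

Local Open Scope classical_set_scope.
Local Open Scope ring_scope.

(** Regard the rows of the triangle as finitely supported functions on the
    integers, with the pairing <f, g> = \sum_k f k * g k.  Passing from one row
    to the next is the operator T that sums a function over the window of
    radius d - 1 around each point.  As the window is symmetric, T is
    self-adjoint ([fsum_window_adjoint]), so <T^n m, T^n m> = <m, T^(2n) m> for
    the initial row m = delta_1 - delta_(-1) ([fsum_motzkin_shift]).  The right
    side is m_(1,2n) - m_(-1,2n) ([fsum_motzkin0]).

    Every row is odd, because m is odd and T commutes with negation
    ([motzkinN]).  Hence the right side is 2 m_(1,2n), while the squares on the
    left form an even function vanishing at 0, whose total is twice its sum
    over the positive integers ([fsum_even]).  Cancelling the factor 2 gives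
    the identity. *)

(** Exchanging the sums requires the supports of all the [F i] to lie in one
    finite set: the sum over [setT] is 0 by convention when the support is
    infinite, so additivity fails in general. *)
Lemma fsum_sum (T : choiceType) (I : finType) (V : nmodType) (A : {fset T})
    (F : I -> T -> V) :
  (forall i k, k \notin A -> F i k = 0) ->
  \sum_(k \in [set: T]) \sum_i F i k = \sum_i \sum_(k \in [set: T]) F i k.
Proof.
move=> F0; rewrite (fsbigTE A); last first.
  by move=> k kA; rewrite big1 // => i _; exact: F0.
rewrite exchange_big; apply: eq_bigr => i _.
by rewrite (fsbigTE A) // => k; exact: F0.
Qed.

Lemma notin_fset_support {T : choiceType} {V : nmodType} {f : T -> V} :
  finite_set [set k | f k != 0] ->
  forall k, k \notin fset_set [set k | f k != 0] -> f k = 0.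
Proof.
move=> ff k; rewrite in_fset_set // => /negP kf.
by apply/eqP; apply: contra_notT kf => fk; exact: mem_set.
Qed.

(** The two halves are exchanged by negation. *)
Lemma fsum_even (V : nmodType) (g : int -> V) :
  finite_set [set k | g k != 0] -> (forall k, g (- k) = g k) -> g 0 = 0 ->
  \sum_(k \in [set: int]) g k = (\sum_(k \in [set k : int | 0 < k]) g k) *+ 2.
Proof.
move=> gfin gN g0.
(* Cutting [g] into its two halves, both defined on all of [int], lets the
   splitting be an instance of [fsum_sum] over [bool]. *)
pose h (b : bool) (k : int) := if 0 < (if b then k else - k) then g k else 0.
have gE k : g k = \sum_b h b k.
  rewrite big_bool /h /=; case: (ltrgt0P k) => [k0|k0|->].
  - by rewrite ifF ?addr0 //; lia.
  - by rewrite ifT ?add0r //; lia.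
  - by rewrite oppr0 ltxx addr0.
have hT : \sum_(k \in [set: int]) h true k
          = \sum_(k \in [set k : int | 0 < k]) g k.
  rewrite [RHS]fsbig_mkcond; apply: eq_fsbigr => k _.
  rewrite /h /patch; case: (boolP (k \in _)) => [/set_mem /= ->//|/negP kn].
  by rewrite ifF //; apply/negP => k0; apply: kn; exact: mem_set.
under eq_fsbigr do rewrite gE.
rewrite (@fsum_sum _ _ _ (fset_set [set k | g k != 0])); last first.
  by move=> b k kA; rewrite /h (notin_fset_support gfin) // if_same.
rewrite big_bool mulr2n /= hT; congr (_ + _).
rewrite -hT (@reindex_fsbigT _ _ _ _ _ (fun k : int => - k)).
  by apply: eq_fsbigr => k _; rewrite /h /= opprK gN.
by exists (fun k => - k); exact: opprK.
Qed.

(** Reversing the window and translating the summation variable turn each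
    term of one side into a term of the other. *)
Lemma fsum_window_adjoint (R : pzRingType) (c : nat) (f g : int -> R) :
  finite_set [set k | f k != 0] -> finite_set [set k | g k != 0] ->
  \sum_(k \in [set: int]) (\sum_(i < (2 * c).+1) f (k - c%:Z + i%:Z)) * g k =
  \sum_(k \in [set: int]) f k * \sum_(i < (2 * c).+1) g (k - c%:Z + i%:Z).
Proof.
move=> ffin gfin.
under eq_fsbigr do rewrite mulr_suml.
under [RHS]eq_fsbigr do rewrite mulr_sumr.
rewrite (@fsum_sum _ _ _ (fset_set [set k | g k != 0])); last first.
  by move=> i k /(notin_fset_support gfin) ->; rewrite mulr0.
rewrite (@fsum_sum _ _ _ (fset_set [set k | f k != 0])); last first.
  by move=> i k /(notin_fset_support ffin) ->; rewrite mul0r.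
rewrite (reindex_inj rev_ord_inj); apply: eq_bigr => i _.
have ltic := ltn_ord i.
rewrite (@reindex_fsbigT _ _ _ _ _ (fun k : int => k - c%:Z + i%:Z)).
  by apply: eq_fsbigr => k _; congr (f _ * g _) => /=; lia.
by exists (fun k => k + c%:Z - i%:Z) => k; lia.
Qed.

(** The window of [motzkin], centred and with its length in successor form. *)
Lemma motzkinS (d n : nat) (k : int) : (0 < d)%N ->
  motzkin d k n.+1 =
  \sum_(i < (2 * d.-1).+1) motzkin d (k - d.-1%:Z + i%:Z) n.
Proof.
move=> d0 /=; have -> : (2 * d - 1 = (2 * d.-1).+1)%N by lia.
by apply: eq_bigr => i _; congr motzkin; lia.
Qed.

Lemma motzkinN (d n : nat) (k : int) : (0 < d)%N ->
  motzkin d (- k) n = - motzkin d k n.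
Proof.
move=> d0; elim: n k => [|n IHn] k.
  by rewrite /=; do ![case: eqP => ?]; lia.
rewrite !motzkinS // -sumrN (reindex_inj rev_ord_inj).
apply: eq_bigr => i _; rewrite -IHn; congr motzkin.
by have := ltn_ord i; rewrite /=; lia.
Qed.

Lemma fsum_motzkin_shift (d n m : nat) : (0 < d)%N ->
  \sum_(k \in [set: int]) motzkin d k n * motzkin d k m =
  \sum_(k \in [set: int]) motzkin d k 0 * motzkin d k (n + m).
Proof.
move=> d0; elim: n m => [//|n IHn] m; rewrite addSnnS -IHn.
under eq_fsbigr do rewrite motzkinS //.
under [RHS]eq_fsbigr do rewrite motzkinS //.
by apply: fsum_window_adjoint; exact: finite_motzkin_support.
Qed.

Lemma fsum_motzkin0 (d : nat) (f : int -> int) :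
  \sum_(k \in [set: int]) motzkin d k 0 * f k = f 1 - f (- 1).
Proof.
rewrite (@fsbigE _ _ _ _ _ [:: 1; -1]) //.
  by rewrite !big_cons big_nil !in_setT /= mul1r mulN1r addr0.
by move=> k _; rewrite !inE /= => /norP[/negPf-> /negPf->]; rewrite mul0r.
Qed.

Theorem proposition4p6 (d : nat) (hd : (2 <= d)%N) (n : nat) :
  motzkin d 1 (2 * n)%N =
  \sum_(k \in [set k : int | 0 < k]) motzkin d k n ^+ 2.
Proof.
have d0 : (0 < d)%N by exact: ltnW.
apply: (@mulIf _ 2) => //.
have sqfin : finite_set [set k | motzkin d k n ^+ 2 != 0].
  apply: sub_finite_set (finite_motzkin_support d n) => k /=.
  by rewrite expf_eq0.
have sqN k : motzkin d (- k) n ^+ 2 = motzkin d k n ^+ 2.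
  by rewrite motzkinN // sqrrN.
have m0 : motzkin d 0 n = 0.
  have /eqP := motzkinN d n 0 d0.
  by rewrite oppr0 -addr_eq0 -mulr2n mulrn_eq0 => /eqP.
rewrite [RHS]mulr_natr -fsum_even ?m0 ?expr0n //.
under eq_fsbigr do rewrite expr2.
rewrite fsum_motzkin_shift // fsum_motzkin0 motzkinN // opprK.
by rewrite addnn -mul2n mulr_natr mulr2n.
Qed.
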